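(* Let $\mathcal{A}$ be a simple central maxout arrangement in $\mathbb{R}^{n+1}$ of $m\ge 1$ maxout units of ranks at least $2$, where for each unit the linear functions are not all equal. Let $g=\{x\in\mathbb{R}^{n+1}:\langle x,w\rangle=1\}$, $w\neq0$, be an affine hyperplane not containing the origin, and let $\mathcal{A}^g=\{g\cap H\ne\emptyset: H\in\mathcal{A},\ H\not\supseteq g\}$ be the induced arrangement on $g$. Then the number of regions of $\mathcal{A}$ which do not intersect $g$, i.e. of regions consisting of points with $\langle x,w\rangle\le0$, satisfies $$r(\mathcal{A})-r(\mathcal{A}^g)\ \ge\ \binom{m-1}{n}.$$
   Context: Central maxout arrangement in $\mathbb{R}^{n+1}$: given $m$ maxout units $z_i(x)=\max\{A_{i,1}(x),\dots,A_{i,k_i}(x)\}$, $x\in\mathbb{R}^{n+1}$, with linear functions $A_{i,a}$, the arrangement is $\mathcal{A}=\{H^i_{ab}: i\in[m],\{a,b\}\in\binom{[k_i]}{2},\ \operatorname{codim}H^i_{ab}=1\}$, where $H^i_{ab}=\{x: A_{i,a}(x)=A_{i,b}(x)=\max_{c\in[k_i]}A_{i,c}(x)\}$. Its elements are called atoms. The regions of $\mathcal{A}$ are the connected components of $\mathbb{R}^{n+1}\setminus\bigcup_{H\in\mathcal{A}}H$ and $r(\mathcal{A})$ is their number; $r(\mathcal{A}^g)$ is the number of connected components of $g\setminus\bigcup_{H\in\mathcal{A}^g}H$. A central maxout arrangement is simple if, for every $j$, the intersection of any $j$ atoms of (pairwise) different units is either $\{0\}$ or has codimension $j$. $\binom{a}{b}=0$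 for $0\le a<b$. *)

(* Defs.v *)
From HB Require Import structures.
From mathcomp Require Import all_boot all_order all_algebra.
From mathcomp Require Import all_classical all_reals all_analysis.

Set Implicit Arguments.
Unset Strict Implicit.
Unset Printing Implicit Defensive.

Import Order.TTheory GRing.Theory Num.Theory.
Import numFieldNormedType.Exports.

Local Open Scope classical_set_scope.
Local Open Scope ring_scope.

Definition dotp (R : realType) (d : nat) (x w : 'rV[R]_d) : R :=
  \sum_(j < d) x ord0 j * w ord0 j.

Definition affine_hyperplane (R : realType) (d : nat) (w : 'rV[R]_d) :
  set 'rV[R]_d := [set x | dotp x w = 1].

(* The affine hull of S has dimension e: V is the direction space of that hull,
   i.e. the least linear subspace containing all differences x - x0. *)
Definition affine_dim (R : realType) (d : nat) (S : set 'rV[R]_d) (e : nat) :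
    Prop :=
  exists (x0 : 'rV[R]_d) (V : {vspace 'rV[R]_d}),
    [/\ S x0, \dim V = e,
        (forall x, S x -> x - x0 \in V) &
        (forall W : {vspace 'rV[R]_d},
           (forall x, S x -> x - x0 \in W) -> (V <= W)%VS)].

Definition has_codim (R : realType) (d : nat) (S : set 'rV[R]_d) (j : nat) :
    Prop :=
  exists2 e, affine_dim S e & (e + j)%N = d.

(* A family [A i a] (unit i, index a < k i) of linear forms encodes the m maxout
   units z_i = max_a A i a. *)
Definition tie_set (R : realType) (d m : nat) (k : 'I_m -> nat)
    (A : forall i : 'I_m, 'I_(k i) -> {scalar 'rV[R]_d})
    (i : 'I_m) (a b : 'I_(k i)) : set 'rV[R]_d :=
  [set x | A i a x = A i b x /\ forall c : 'I_(k i), A i c x <= A i a x].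

Definition atoms_of_unit (R : realType) (d m : nat) (k : 'I_m -> nat)
    (A : forall i : 'I_m, 'I_(k i) -> {scalar 'rV[R]_d})
    (i : 'I_m) : set (set 'rV[R]_d) :=
  [set H | exists a b : 'I_(k i),
     [/\ a != b, H = tie_set A a b & has_codim H 1]].

Definition maxout_arrangement (R : realType) (d m : nat) (k : 'I_m -> nat)
    (A : forall i : 'I_m, 'I_(k i) -> {scalar 'rV[R]_d}) :
    set (set 'rV[R]_d) :=
  [set H | exists i : 'I_m, atoms_of_unit A i H].

Definition simple_arrangement (R : realType) (d m : nat) (k : 'I_m -> nat)
    (A : forall i : 'I_m, 'I_(k i) -> {scalar 'rV[R]_d}) : Prop :=
  forall (J : {set 'I_m}) (H : 'I_m -> set 'rV[R]_d),
    (forall i, i \in J -> atoms_of_unit A i (H i)) ->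
    \bigcap_(i in [set` J]) H i = [set 0] \/
    has_codim (\bigcap_(i in [set` J]) H i) #|J|.

Definition induced_arrangement (R : realType) (d : nat)
    (g : set 'rV[R]_d) (arr : set (set 'rV[R]_d)) : set (set 'rV[R]_d) :=
  [set K | exists H, [/\ arr H, ~ (g `<=` H), K = g `&` H & K !=set0]].

(* Connected components, in the ambient space E, of the complement of the
   union of the arrangement. *)
Definition regions (R : realType) (d : nat)
    (E : set 'rV[R]_d) (arr : set (set 'rV[R]_d)) : set (set 'rV[R]_d) :=
  [set connected_component (E `\` \bigcup_(H in arr) H) x
     | x in E `\` \bigcup_(H in arr) H].

(* Main.v *)
Require Import Defs.
From HB Require Import structures.
From mathcomp Require Import all_boot all_order all_algebra.
From mathcomp Require Import all_classical all_reals all_analysis.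
From mathcomp Require Import ring lra.
Import Order.TTheory GRing.Theory Num.Theory.
Import numFieldNormedType.Exports.
Local Open Scope card_scope.
Local Open Scope classical_set_scope.
Local Open Scope ring_scope.

(** Write [E_T] for the cone of points where all units of a set [T] tie. For
every linear form [w], [E_T] contains a nonzero point with [w <= 0] as long as
#|T| is less than the dimension ([tied_extension]). Let |S| = n and fix a unit i0
outside S. A ray p of [E_S] with [w <= 0] has some piece [a] of i0 strictly
active, so [w] plus a nonnegative multiple of the excess [h] of [a] over the
other pieces of i0 vanishes at p. Around p only the n units of S are nontrivial,
in n dimensions transversally to p, and by induction on dimension they have a
cell on which this combination is nonpositive; hence [w <= - c h] on that cell,
with equality at p, and the cell misses the hyperplane. For generic [w] the ray
p, and therefore S, can be recovered from the cell, which gives [binomial (m-1) n]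
cells. A small perturbation makes [w] generic without creating new cells below
the hyperplane. Local arrangements are handled without quotients, by lexicographic
maximisation along flags of orthogonal vectors. *)

(** * Inner product, Euclidean norm and orthogonal flags *)

Section Dotp.
Set Implicit Arguments.
Unset Strict Implicit.
Context {R : realType} {d : nat}.
Implicit Types (x y z u v w : 'rV[R]_d) (t s : R).

Lemma dotpC x y : dotp x y = dotp y x.
Proof. by apply: eq_bigr => j _; rewrite mulrC. Qed.

Lemma dotpDl x y w : dotp (x + y) w = dotp x w + dotp y w.
Proof. by rewrite -big_split; apply: eq_bigr => j _; rewrite mxE mulrDl. Qed.

Lemma dotpZl t x w : dotp (t *: x) w = t * dotp x w.
Proof. by rewrite /dotp mulr_sumr; apply: eq_bigr => j _; rewrite mxE mulrA. Qed.

Lemma dotpDr x y w : dotp w (x + y) = dotp w x + dotp w y.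
Proof. by rewrite !(dotpC w) dotpDl. Qed.

Lemma dotpZr t x w : dotp w (t *: x) = t * dotp w x.
Proof. by rewrite !(dotpC w) dotpZl. Qed.

Lemma dotpNl x w : dotp (- x) w = - dotp x w.
Proof. by rewrite -scaleN1r dotpZl mulN1r. Qed.

Lemma dotpNr x w : dotp w (- x) = - dotp w x.
Proof. by rewrite !(dotpC w) dotpNl. Qed.

Lemma dotpBl x y w : dotp (x - y) w = dotp x w - dotp y w.
Proof. by rewrite dotpDl dotpNl. Qed.

Lemma dotpBr x y w : dotp w (x - y) = dotp w x - dotp w y.
Proof. by rewrite dotpDr dotpNr. Qed.

Lemma dotp0l w : dotp 0 w = 0.
Proof. by rewrite -(scale0r 0) dotpZl mul0r. Qed.

Lemma dotp0r w : dotp w 0 = 0.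
Proof. by rewrite dotpC dotp0l. Qed.

Lemma dotp_sumr (I : Type) (r : seq I) (P : pred I) (F : I -> 'rV[R]_d) w :
  dotp w (\sum_(i <- r | P i) F i) = \sum_(i <- r | P i) dotp w (F i).
Proof. exact: (big_morph (dotp w) (fun x y => dotpDr x y w) (dotp0r w)). Qed.

Lemma dotpxx_ge0 x : 0 <= dotp x x.
Proof. by apply: sumr_ge0 => j _; rewrite -expr2 sqr_ge0. Qed.

Lemma dotpxx_gt0 x : x != 0 -> 0 < dotp x x.
Proof.
move=> xN0; rewrite lt_def dotpxx_ge0 andbT; apply: contra_neq xN0 => xx0.
apply/rowP => j; rewrite mxE; apply/eqP; rewrite -sqrf_eq0 expr2.
by move/psumr_eq0P: xx0 => -> // i _; rewrite -expr2 sqr_ge0.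
Qed.

Definition enorm x := Num.sqrt (dotp x x).

Lemma enorm_ge0 x : 0 <= enorm x.
Proof. exact: sqrtr_ge0. Qed.

Lemma enorm_gt0 x : x != 0 -> 0 < enorm x.
Proof. by move=> x0; rewrite sqrtr_gt0 dotpxx_gt0. Qed.

Lemma sqr_enorm x : enorm x ^+ 2 = dotp x x.
Proof. by rewrite sqr_sqrtr // dotpxx_ge0. Qed.

Lemma enorm0 : enorm 0 = 0.
Proof. by rewrite /enorm dotp0l sqrtr0. Qed.

Lemma enormZ t x : enorm (t *: x) = `|t| * enorm x.
Proof.
rewrite /enorm dotpZl dotpZr mulrA -expr2 sqrtrM ?sqr_ge0 //.
by rewrite sqrtr_sqr.
Qed.

Lemma dotp_le_enorm x y : dotp x y <= enorm x * enorm y.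
Proof.
have [->|x0] := eqVneq x 0; first by rewrite dotp0l enorm0 mul0r.
have [->|y0] := eqVneq y 0; first by rewrite dotp0r enorm0 mulr0.
have := dotpxx_ge0 (enorm y *: x - enorm x *: y).
rewrite !(dotpBl, dotpBr, dotpZl, dotpZr) -!sqr_enorm (dotpC y x).
have := enorm_gt0 x0; have := enorm_gt0 y0.
move: (enorm x) (enorm y) (dotp x y) => a b c b0 a0 h.
have {}h : 0 <= (a * b) * (a * b - c) by nra.
by rewrite pmulr_rge0 ?mulr_gt0 // subr_ge0 in h.
Qed.

Lemma enorm_lt_orthoD x y : y != 0 -> dotp x y = 0 -> enorm x < enorm (x + y).
Proof.
move=> y0 xy; rewrite /enorm ltr_sqrt.
  by rewrite !(dotpDl, dotpDr) (dotpC y x) xy addr0 add0r ltrDl dotpxx_gt0.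
rewrite !(dotpDl, dotpDr) (dotpC y x) xy addr0 add0r.
by rewrite ltr_wpDl ?dotpxx_ge0 // dotpxx_gt0.
Qed.

Lemma coord_le_enorm x j : `|x ord0 j| <= enorm x.
Proof.
rewrite -(@ler_sqr _ `|_|) ?nnegrE ?enorm_ge0 // sqr_enorm real_normK ?num_real //.
rewrite /dotp (bigD1 j) //= -expr2 lerDl.
by apply: sumr_ge0 => i _; rewrite -expr2 sqr_ge0.
Qed.

(* 1 / 0 = 0 makes the indices with [c i = 0] contribute nothing. *)
Lemma small_scale (I : finType) (c s : I -> R) :
  exists2 t, 0 < t & forall i, c i != 0 -> t * `|s i| < `|c i|.
Proof.
pose M := \sum_i `|s i| / `|c i|.
have M0 : 0 <= M by apply: sumr_ge0 => i _; rewrite divr_ge0.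
exists (1 + M)^-1; first by rewrite invr_gt0; lra.
move=> i ci; have ci0 : 0 < `|c i| by rewrite normr_gt0.
rewrite mulrC ltr_pdivrMr; last by lra.
rewrite -ltr_pdivrMl // mulrC.
have : `|s i| / `|c i| <= M.
  rewrite /M (bigD1 i) //= lerDl.
  by apply: sumr_ge0 => j _; rewrite divr_ge0.
by lra.
Qed.

(** Fewer than d linear conditions on d coordinates leave a nontrivial kernel. *)
Lemma exists_ortho (xs : seq 'rV[R]_d) : (size xs < d)%N ->
  exists2 y, y != 0 & forall x, x \in xs -> dotp x y = 0.
Proof.
move=> sz.
pose M := \matrix_(i < d, j < size xs) (xs`_j) ord0 i.
have /rowV0Pn[y /sub_kermxP yM y0] : kermx M != 0.
  by rewrite kermx_eq0 /row_free neq_ltn (leq_ltn_trans (rank_leq_col _)).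
exists y => // x xin; rewrite -(nth_index 0 xin).
have jlt : (index x xs < size xs)%N by rewrite index_mem.
have /rowP/(_ (Ordinal jlt)) := yM; rewrite !mxE => h.
by rewrite -[RHS]h; apply: eq_bigr => i _; rewrite !mxE mulrC.
Qed.

(* Flags are listed with the most recent vector first. *)
Fixpoint ortho_flag (xs : seq 'rV[R]_d) : Prop :=
  if xs is x :: xs' then
    [/\ x != 0, forall y, y \in xs' -> dotp y x = 0 & ortho_flag xs']
  else True.

Lemma span_ortho (xs : seq 'rV[R]_d) w : (forall x, x \in xs -> dotp x w = 0) ->
  forall x, x \in <<xs>>%VS -> dotp x w = 0.
Proof.
move=> h x; rewrite -[xs]/(val (in_tuple xs)) => /coord_span ->.
rewrite dotpC dotp_sumr big1 // => i _.
by rewrite dotpZr dotpC h ?mulr0 //= mem_nth.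
Qed.

Lemma ortho_free xs : ortho_flag xs -> free xs.
Proof.
elim: xs => [|x xs IH] /=; first by rewrite nil_free.
move=> [x0 xxs /IH fr]; rewrite free_cons fr andbT.
apply/negP => /(span_ortho xxs)/eqP.
by rewrite gt_eqF // dotpxx_gt0.
Qed.

Lemma ortho_size_le xs (V : {vspace 'rV[R]_d}) : ortho_flag xs ->
  (forall x, x \in xs -> x \in V) -> (size xs <= \dim V)%N.
Proof.
move=> /ortho_free/eqP <- h; apply: dimvS; apply/span_subvP => x; exact: h.
Qed.

Lemma ortho_size xs : ortho_flag xs -> (size xs <= d)%N.
Proof.
move=> oxs; rewrite (leq_trans (ortho_size_le (V := fullv) oxs _)) //.
  by move=> x _; rewrite memvf.
by rewrite dimvf /dim /= mul1n.
Qed.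

End Dotp.

(** * Existence of minima on closed sets and closed cones *)

Section EuclideanTopology.
Set Implicit Arguments.
Unset Strict Implicit.
Context {R : realType} {d : nat}.
Implicit Types (x y w : 'rV[R]_d) (K : set 'rV[R]_d).

Lemma continuous_dotp w : continuous (fun x => dotp x w).
Proof.
apply: continuous_big => [|j _ x]; first exact: add_continuous.
by apply: continuousM; [exact: coord_continuous | exact: cst_continuous].
Qed.

Lemma continuous_enorm : continuous (@enorm R d).
Proof.
have c : continuous (fun x : 'rV[R]_d => dotp x x).
  apply: continuous_big => [|j _ x]; first exact: add_continuous.
  by apply: continuousM; exact: coord_continuous.
by move=> x; apply: (continuous_comp (c x)); exact: sqrt_continuous.
Qed.

Lemma closed_level (f : 'rV[R]_d -> R) (D : set R) :
  continuous f -> closed D -> closed (f @^-1` D).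
Proof. by move=> cf cD; apply: closed_comp => // x _; exact: cf. Qed.

Lemma mx_norm_le_enorm x : `|x| <= enorm x.
Proof.
rewrite [leLHS]/Num.norm /= mx_normrE; apply: bigmax_le; first exact: enorm_ge0.
by move=> [i j] _ /=; rewrite ord1 coord_le_enorm.
Qed.

(** The lower bound makes the sublevel set of f at a point of K bounded, hence compact. *)
Lemma coercive_min K (f : 'rV[R]_d -> R) (e : R) : 0 < e -> closed K ->
  K !=set0 -> continuous f -> (forall x, K x -> e * enorm x <= f x) ->
  exists2 c, K c & forall x, K x -> f c <= f x.
Proof.
move=> e0 cK [x0 Kx0] cf lb.
pose K' := K `&` f @^-1` [set r | r <= f x0].
have cK' : compact K'.
  apply: bounded_closed_compact; last first.
    by apply: closedI => //; exact: closed_level.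
  exists (f x0 / e); split; first exact: num_real.
  move=> M ltM x [Kx fx]; apply: le_trans (mx_norm_le_enorm _) _.
  apply: le_trans (ltW ltM); rewrite ler_pdivlMr // mulrC.
  exact: le_trans (lb _ Kx) fx.
have K'0 : K' !=set0 by exists x0; split => /=.
have [c cin cmin] := EVT_min_rV K'0 cK' (continuous_subspaceT cf).
have [Kc fc] := set_mem cin.
exists c => // x Kx; have [fx|fx] := leP (f x) (f x0).
  by apply: cmin; apply/mem_set.
exact: le_trans fc (ltW fx).
Qed.

(** The constant is the minimum of w on the compact trace of K on the unit sphere; homogeneity
    spreads the bound over the cone. *)
Lemma cone_linear_bound K w : closed K ->
  (forall t x, 0 < t -> K x -> K (t *: x)) ->
  (forall x, K x -> x != 0 -> 0 < dotp x w) ->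
  exists2 e, 0 < e & forall x, K x -> e * enorm x <= dotp x w.
Proof.
move=> cK coneK posK.
pose K1 := K `&` @enorm R d @^-1` [set 1].
have cK1 : closed K1.
  by apply: closedI => //; apply: closed_level => //; exact: continuous_enorm.
have nK x : K x -> x != 0 -> K1 ((enorm x)^-1 *: x).
  move=> Kx x0; have n0 := enorm_gt0 x0; split; first by apply: coneK; rewrite ?invr_gt0.
  by rewrite /= enormZ ger0_norm ?invr_ge0 ?ltW // mulVf // gt_eqF.
(* If K misses the sphere it has no nonzero point, and any positive constant will do. *)
have [K10|/set0P K1N] := eqVneq K1 set0.
  exists 1 => // x Kx; have [->|x0] := eqVneq x 0.
    by rewrite enorm0 dotp0l mulr0.
  by have := nK x Kx x0; rewrite K10.
have [c Kc cmin] : exists2 c, K1 c & forall x, K1 x -> dotp c w <= dotp x w.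
  have cK1' : compact K1.
    apply: bounded_closed_compact => //; exists 1; split; first exact: num_real.
    move=> M ltM x [_ /= x1]; apply: le_trans (mx_norm_le_enorm _) _.
    by rewrite x1 ltW.
  have [c /set_mem cin cmin] :=
    EVT_min_rV K1N cK1' (continuous_subspaceT (@continuous_dotp w)).
  by exists c => // x Kx; apply: cmin; apply/mem_set.
exists (dotp c w).
  have [Kc1 /= c1] := Kc; apply: posK => //.
  by apply: contra_eq_neq c1 => ->; rewrite enorm0 eq_sym oner_neq0.
move=> x Kx; have [->|x0] := eqVneq x 0; first by rewrite enorm0 dotp0l mulr0.
have := cmin _ (nK x Kx x0); rewrite dotpZl mulrC ler_pdivlMr //.
exact: enorm_gt0.
Qed.

End EuclideanTopology.

(** * Pieces active along a flag, and ties between them *)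

Section Active.
Set Implicit Arguments.
Unset Strict Implicit.
Context {R : realType} {d : nat} {I : finType} {K : I -> finType}.
Variables (alpha : forall i, K i -> 'rV[R]_d) (k0 : forall i, K i).
Implicit Types (x y z w : 'rV[R]_d) (xs : seq 'rV[R]_d).

(* The pieces of unit [i] that are lexicographically maximal along the flag
   [xs]; these are the pieces active at x1 + e x2 + e^2 x3 + ... for small e,
   where x1 is the last entry of [xs]. *)
Fixpoint act xs i (a : K i) : Prop :=
  if xs is x :: xs' then
    act xs' a /\ forall b : K i, act xs' b -> dotp x (alpha b) <= dotp x (alpha a)
  else True.

Definition tied xs (i : I) : Prop :=
  exists a b : K i, [/\ act xs a, act xs b & alpha a <> alpha b].

Lemma act_tail x xs i (a : K i) : act (x :: xs) a -> act xs a.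
Proof. by case. Qed.

Lemma act_nonempty xs i : exists a : K i, act xs a.
Proof.
elim: xs => [|x xs [a0 ha0]]; first by exists (k0 i).
pose P := [pred a : K i | `[< act xs a >]].
have Pa0 : P a0 by apply/asboolP.
case: (@arg_maxP _ _ _ a0 P (fun a => dotp x (alpha a)) Pa0) => a /asboolP Pa amax.
exists a; split => // b hb; apply: amax; exact/asboolP.
Qed.

Lemma act_val xs i (a b : K i) x : act xs a -> act xs b -> x \in xs ->
  dotp x (alpha a) = dotp x (alpha b).
Proof.
elim: xs => [//|y xs IH] [ha ha'] [hb hb']; rewrite inE => /predU1P[->|].
  by apply/eqP; rewrite eq_le ha' // hb'.
exact: IH.
Qed.

Lemma act_cons_sub x xs ys i (a : K i) :
  (forall b : K i, act xs b -> act ys b) ->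
  act xs a -> act (x :: ys) a -> act (x :: xs) a.
Proof. by move=> sub ha [_ h]; split => // b /sub; exact: h. Qed.

(** All pieces active along [xs] agree at x, so a multiple of x shifts their values equally. *)
Lemma act_shift y x xs (s : R) i (a : K i) : x \in xs ->
  act (y + s *: x :: xs) a <-> act (y :: xs) a.
Proof.
move=> xin; split=> -[ha h]; split => // b hb; have := h b hb;
  by rewrite !dotpDl !dotpZl (act_val ha hb xin) lerD2r.
Qed.

Lemma act_scale x xs (s : R) i (a : K i) : 0 < s ->
  act (s *: x :: xs) a <-> act (x :: xs) a.
Proof.
move=> s0; split=> -[ha h]; split => // b hb; have := h b hb;
  by rewrite !dotpZl ler_pM2l.
Qed.

(** Finitely many strict gaps at x survive a small step along y, while pieces with equal values at x
    are ordered by y. One t serves all units and pieces. *)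
Lemma act_pert x y xs : exists2 t, 0 < t &
  forall i (a : K i), act (x + t *: y :: xs) a <-> act (y :: x :: xs) a.
Proof.
pose S := {i : I & (K i * K i)%type}.
pose c (s : S) := dotp x (alpha (tagged s).1) - dotp x (alpha (tagged s).2).
pose e (s : S) := dotp y (alpha (tagged s).1) - dotp y (alpha (tagged s).2).
have [t t0 ht] := small_scale c e.
have lt_pert i (a b : K i) : dotp x (alpha b) < dotp x (alpha a) ->
    dotp (x + t *: y) (alpha b) < dotp (x + t *: y) (alpha a).
  move=> ba; have := ht (Tagged (fun i => (K i * K i)%type) (a, b)).
  rewrite /c /e /= subr_eq0 gt_eqF // => /(_ isT).
  rewrite -[t in t * _]gtr0_norm // -normrM !dotpDl !dotpZl [ltRHS]ger0_norm.
    by rewrite ltr_norml => /andP[+ _]; lra.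
  by rewrite subr_ge0 ltW.
exists t => // i a; split.
  move=> [ha h].
  have ha' : act (x :: xs) a.
    split => // b hb; rewrite leNgt; apply/negP => /lt_pert.
    by rewrite ltNge h.
  split => // b [hb hb'].
  have eqx : dotp x (alpha b) = dotp x (alpha a).
    by apply/eqP; rewrite eq_le ha'.2 // hb'.
  by have := h b hb; rewrite !dotpDl !dotpZl eqx lerD2l ler_pM2l.
move=> [[ha ha'] h]; split => // b hb.
have := ha' b hb; rewrite le_eqVlt => /predU1P[eqx|/lt_pert/ltW //].
have hb' : act (x :: xs) b by split => // b' /ha'; rewrite eqx.
by rewrite !dotpDl !dotpZl eqx lerD2l ler_pM2l // h.
Qed.

Lemma tied_iff xs ys i : (forall a : K i, act xs a <-> act ys a) ->
  tied xs i <-> tied ys i.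
Proof.
by move=> h; split=> -[a [b [/h ha /h hb ab]]]; exists a, b.
Qed.

Lemma tied_tail x xs i : tied (x :: xs) i -> tied xs i.
Proof. by move=> [a [b [[ha _] [hb _] ab]]]; exists a, b. Qed.

Lemma untiedE xs i (a b : K i) : ~ tied xs i -> act xs a -> act xs b ->
  alpha a = alpha b.
Proof. by move=> nt ha hb; apply: contrapT => ab; apply: nt; exists a, b. Qed.

Lemma closed_act xs i (a : K i) : closed [set y | act (y :: xs) a].
Proof.
have [ha|ha] := pselect (act xs a); last first.
  rewrite (_ : [set _ | _] = set0); first exact: closed0.
  by apply/seteqP; split => // y [].
rewrite (_ : [set _ | _] = \bigcap_(b in [set b : K i | act xs b])
    (fun y => dotp y (alpha a - alpha b)) @^-1` [set r | 0 <= r]).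
  apply: closed_bigI => b _; apply: closed_level; last exact: closed_ge.
  exact: continuous_dotp.
apply/seteqP; split => y /=.
  by move=> [_ h] b /= /h; rewrite dotpBr subr_ge0.
by move=> h; split => // b /h; rewrite /= dotpBr subr_ge0.
Qed.

Lemma closed_tied xs i : closed [set y | tied (y :: xs) i].
Proof.
rewrite (_ : [set _ | _] = \bigcup_(p in [set p : K i * K i | alpha p.1 <> alpha p.2])
    ([set y | act (y :: xs) p.1] `&` [set y | act (y :: xs) p.2])).
  apply: closed_bigcup; first exact: finite_finset.
  by move=> p _; apply: closedI; exact: closed_act.
apply/seteqP; split => y /=.
  by move=> [a [b [ha hb ab]]]; exists (a, b).
by move=> [[a b] /= ab [ha hb]]; exists a, b.
Qed.

End Active.

(** * Points with nonpositive value on cones of ties *)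

Section TiedExtension.
Set Implicit Arguments.
Unset Strict Implicit.
Context {R : realType} {d : nat} {I : finType} {K : I -> finType}.
Variables (alpha : forall i, K i -> 'rV[R]_d) (k0 : forall i, K i).
Implicit Types (x y z w : 'rV[R]_d) (xs : seq 'rV[R]_d) (T : {set I}).
Local Notation act := (act alpha).
Local Notation tied := (tied alpha).

(** Restricting to the orthogonal complement of the flag stands in for the quotient by its span. *)
Definition tied_cone xs T : set 'rV[R]_d :=
  [set y | (forall x, x \in xs -> dotp x y = 0) /\
           (forall i, i \in T -> tied (y :: xs) i)].

Lemma closed_tied_cone xs T : closed (tied_cone xs T).
Proof.
rewrite (_ : tied_cone xs T =
    (\bigcap_(x in [set` xs]) (fun y => dotp y x) @^-1` [set 0]) `&`
    (\bigcap_(i in [set` T]) [set y | tied (y :: xs) i])).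
  apply: closedI; apply: closed_bigI => j _; last exact: closed_tied.
  by apply: closed_level; [exact: continuous_dotp | exact: closed_eq].
apply/seteqP; split => y [h1 h2]; split => // x xin.
- by rewrite /= dotpC h1.
- by rewrite dotpC; exact: h1.
Qed.

Lemma tied_coneZ xs T t y : 0 < t -> tied_cone xs T y ->
  tied_cone xs T (t *: y).
Proof.
move=> t0 [oy ty]; split=> [x xin|i iT]; first by rewrite dotpZr oy // mulr0.
exact: (tied_iff (fun a => act_scale _ y xs a t0)).2 (ty i iT).
Qed.

Lemma continuous_dotp_sub_enorm w (e : R) :
  continuous (fun y => dotp y w - e * enorm y).
Proof.
move=> y; have cy : {for y, continuous (fun y => e * enorm y)}.
  by apply: continuousM; [exact: cst_continuous | exact: continuous_enorm].
exact: (continuousB (@continuous_dotp R d w y) cy).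
Qed.

(* Minimise [l - e |.|] over the slice of [D] where [w = -1]. At a minimiser x1
   the strict growth of the norm orthogonally to x1 makes the first-order
   inequality strict. *)
Lemma slice_minimizer (D : set 'rV[R]_d) l w p :
  closed D -> (forall t y, 0 < t -> D y -> D (t *: y)) ->
  D p -> dotp p w < 0 ->
  (forall y, D y -> dotp y w <= 0 -> y != 0 -> 0 < dotp y l) ->
  exists x1 u, [/\ D x1, dotp x1 w = -1 &
    forall y t, 0 < t -> dotp x1 y = 0 -> y != 0 ->
      D (x1 + t *: (y + dotp y w *: x1)) -> 0 < dotp y u].
Proof.
move=> cD coneD Dp pw lpos.
pose E := D `&` [set y | dotp y w <= 0].
have cE : closed E.
  apply: closedI => //; apply: (closed_level _ (@closed_le R 0)).
  exact: continuous_dotp.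
have coneE t y : 0 < t -> E y -> E (t *: y).
  move=> t0 [Dy yw]; split; first exact: coneD.
  by rewrite /= dotpZl pmulr_rle0.
have [e0 e0_gt0 le0] : exists2 e, 0 < e & forall y, E y -> e * enorm y <= dotp y l.
  by apply: cone_linear_bound => // y [Dy yw]; exact: lpos.
(* Only half of the growth of l is given up to the norm, so [l - e |.|] still grows at rate e on the
   slice. *)
pose e := e0 / 2; have e_gt0 : 0 < e by rewrite divr_gt0.
pose X := D `&` [set y | dotp y w = -1].
pose f y := dotp y l - e * enorm y.
have cX : closed X.
  apply: closedI => //; apply: (closed_level _ (@closed_eq R (-1))).
  exact: continuous_dotp.
have XE y : X y -> E y by move=> [Dy yw]; split => //=; rewrite yw lerN10.
have X0 : X !=set0.
  exists ((- dotp p w)^-1 *: p); split.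
    by apply: coneD; rewrite ?invr_gt0 ?oppr_gt0.
  by rewrite /= dotpZl invrN mulNr mulVf ?lt_eqF.
have lbf y : X y -> e * enorm y <= f y.
  move=> Xy; rewrite /f lerBrDr -mulrDl; apply: le_trans (le0 _ (XE _ Xy)).
  by rewrite /e; apply: ler_wpM2r; [exact: enorm_ge0 | lra].
have [x1 [Dx1 x1w] minx1] := coercive_min e_gt0 cX X0
  (@continuous_dotp_sub_enorm l e) lbf.
(* As w is -1 at x1, the vector [y + dotp y w *: x1] is tangent to the slice. Pairing y with this u
   gives the derivative at x1 of [l - e |.|] in that direction, for y orthogonal to x1. *)
exists x1, (l + (dotp x1 l - e * enorm x1) *: w); split => // y t t0 x1y y0 Dz.
set s := dotp y w in Dz *.
have zw : dotp (x1 + t *: (y + s *: x1)) w = -1.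
  by rewrite dotpDl dotpZl dotpDl dotpZl x1w -/s; ring.
have := minx1 _ (conj Dz zw).
have zE : x1 + t *: (y + s *: x1) = (1 + t * s) *: x1 + t *: y.
  by rewrite scalerDr scalerDl scale1r scalerA addrAC addrA.
have : (1 + t * s) * enorm x1 < enorm ((1 + t * s) *: x1 + t *: y).
  apply: le_lt_trans (enorm_lt_orthoD _ _); last 2 first.
  - by rewrite scaler_eq0 negb_or gt_eqF.
  - by rewrite dotpZl dotpZr x1y !mulr0.
  by rewrite enormZ ler_wpM2r ?enorm_ge0 // ler_norm.
rewrite -zE dotpDl dotpZl dotpDl dotpZl dotpDr dotpZr -/s.
move: (enorm _) (enorm x1) (dotp y l) (dotp x1 l) => n2 n1 yl xl h1 h2.
have {}h1 : e * ((1 + t * s) * n1) < e * n2 by rewrite ltr_pM2l.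
have : 0 < t * (yl + (xl - e * n1) * s) by lra.
by rewrite pmulr_rgt0.
Qed.

(* With [T = i |: T'], suppose [w > 0] on the cone where all of [T] is tied.
   On the slice [w = -1] of the cone of [T'] some piece [a] of [i] is strictly
   active; minimising how much [a] exceeds the others leads to a point x1
   whose local cone contradicts the induction hypothesis for [x1 :: xs]. *)
Lemma tied_extension xs T w : (size xs + #|T| < d)%N ->
  (forall i, i \in T -> tied xs i) ->
  exists y, [/\ y != 0, tied_cone xs T y & dotp y w <= 0].
Proof.
move: {2}#|T| (leqnn #|T|) => n; elim: n => [|n IH] in T xs w *.
  rewrite leqn0 cards_eq0 => /eqP ->; rewrite cards0 addn0 => sz _.
  have [y y0 oy] := exists_ortho sz.
  have [yw|yw] := leP (dotp y w) 0.
    by exists y; split => //; split => // i; rewrite inE.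
  exists (- y); split; [by rewrite oppr_eq0 | split | by rewrite dotpNl oppr_le0 ltW].
    by move=> x xin; rewrite dotpNr oy ?oppr0.
  by move=> i; rewrite inE.
have [->|[i iT]] := set_0Vmem T; first by move=> _ sz tT; apply: IH => //; rewrite cards0.
move=> cT sz tT; pose T' := T :\ i.
have cT' : #|T'|.+1 = #|T| by rewrite (cardsD1 i T) iT.
have T'T j : j \in T' -> j \in T by rewrite inE => /andP[].
have cT'n : (#|T'| <= n)%N by rewrite -ltnS cT'.
apply: contrapT => noy.
have wpos y : tied_cone xs T y -> y != 0 -> 0 < dotp y w.
  by move=> ty y0; rewrite ltNge; apply/negP => yw; apply: noy; exists y.
have [p [p0 tp pw]] : exists y, [/\ y != 0, tied_cone xs T' y & dotp y w <= 0].
  apply: IH => //; last by move=> j /T'T/tT.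
  by apply: leq_ltn_trans sz; rewrite leq_add2l -cT'.
have [e e0 he] := cone_linear_bound (@closed_tied_cone xs T)
  (fun t y => @tied_coneZ xs T t y) wpos.
(* This tilt makes the value at p strictly negative and costs at most [e / 2] times the norm, so
   positivity on the cone of T survives. *)
pose w' := w - (e / 2 / enorm p) *: p.
have np := enorm_gt0 p0.
have pw' : dotp p w' < 0.
  rewrite dotpBr dotpZr -sqr_enorm expr2 mulrA divfK ?gt_eqF //.
  have : 0 < e / 2 * enorm p by rewrite mulr_gt0 ?divr_gt0.
  by lra.
have wpos' y : tied_cone xs T y -> y != 0 -> 0 < dotp y w'.
  move=> ty y0; have ny := enorm_gt0 y0.
  rewrite dotpBr dotpZr; have := he y ty.
  have : e / 2 / enorm p * dotp y p <= e / 2 * enorm y.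
    rewrite -mulrA ler_wpM2l ?divr_ge0 ?(ltW e0) // mulrC ler_pdivrMr //.
    exact: dotp_le_enorm.
  have : 0 < e * enorm y by rewrite mulr_gt0.
  by lra.
have [a ha] := act_nonempty alpha k0 (p :: xs) i.
pose D := tied_cone xs T' `&` [set y | act (y :: xs) a].
(* On D each summand is nonnegative. If the sum vanishes, all pieces of i active along [xs] agree,
   and since i is tied along [xs] it is then tied at y as well. *)
pose l := \sum_(b : K i | `[< act xs b >]) (alpha a - alpha b).
have DT y : D y -> tied (y :: xs) i -> tied_cone xs T y.
  move=> [[oy ty] _] tyi; split => // j jT.
  by have [->//|ji] := eqVneq j i; apply: ty; rewrite !inE ji.
have lpos y : D y -> dotp y w' <= 0 -> y != 0 -> 0 < dotp y l.
  move=> Dy yw' y0.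
  have [_ [_ amax]] := Dy.
  have term (b : K i) : `[< act xs b >] -> 0 <= dotp y (alpha a - alpha b).
    by move=> /asboolP hb; rewrite dotpBr subr_ge0 amax.
  rewrite /l dotp_sumr lt_def sumr_ge0 // andbT; apply/eqP => l0.
  have eqv (b : K i) : act xs b -> dotp y (alpha a) = dotp y (alpha b).
    move=> hb; apply/eqP; rewrite -subr_eq0 -dotpBr.
    by apply/eqP/(psumr_eq0P term l0); exact/asboolP.
  have : tied_cone xs T y.
    apply: DT => //; have [b [c [hb hc bc]]] := tT i iT.
    exists b, c; split => //; split => // b' hb'.
      by rewrite -(eqv _ hb) -(eqv _ hb').
    by rewrite -(eqv _ hc) -(eqv _ hb').
  by move=> /wpos'/(_ y0); rewrite ltNge yw'.
have [||x1 [u [Dx1 x1w hu]]] := slice_minimizer _ _ (conj tp ha : D p) pw' lpos.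
- by apply: closedI; [exact: closed_tied_cone | exact: closed_act].
- by move=> t y t0 [ty ay]; split; [exact: tied_coneZ | apply/act_scale].
have nt : ~ tied (x1 :: xs) i.
  move=> /(DT _ Dx1)/wpos'; rewrite x1w => h.
  have : x1 != 0 by apply: contra_eq_neq x1w => ->; rewrite dotp0l eq_sym oppr_eq0 oner_neq0.
  by move/h; rewrite ltr0N1.
have [[ox1 tx1] ax1] := Dx1.
have [y [y0 [oy ty] yu]] : exists y, [/\ y != 0, tied_cone (x1 :: xs) T' y & dotp y u <= 0].
  by apply: IH => //=; rewrite addSnnS cT'.
have [t t0 ht] := act_pert alpha x1 (y + dotp y w' *: x1) xs.
suff /(hu y t t0 (oy _ (mem_head _ _)) y0) : D (x1 + t *: (y + dotp y w' *: x1)).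
  by rewrite ltNge yu.
split; first split.
- move=> x xin; have xin1 : x \in x1 :: xs by rewrite inE xin orbT.
  by rewrite dotpDr dotpZr dotpDr dotpZr ox1 // (oy x xin1); ring.
- move=> j jT; apply/(tied_iff (ht j)).
  by apply/(tied_iff (fun a => act_shift _ y _ a (mem_head x1 xs))); exact: ty.
(* Since i is untied at x1, its pieces active there share the gradient of a, and no direction can
   separate them. *)
apply/ht; split => // b hb; rewrite (untiedE nt ax1 hb) //.
Qed.

End TiedExtension.

(** * Closed cells contained in a half-space *)

Section Cells.
Set Implicit Arguments.
Unset Strict Implicit.
Context {R : realType} {d : nat} {I : finType} {K : I -> finType}.
Variables (alpha : forall i, K i -> 'rV[R]_d) (k0 : forall i, K i).
Implicit Types (x y z w u : 'rV[R]_d) (xs : seq 'rV[R]_d) (T : {set I}).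
Local Notation act := (act alpha).
Local Notation tied := (tied alpha).

(* This is all that is used of simplicity: along a flag of j >= 1 vectors, at
   most d - j units remain tied. *)
Definition few_ties := forall x xs T, ortho_flag (x :: xs) ->
  (forall i, i \in T -> tied (x :: xs) i) -> (#|T| + size xs < d)%N.

(** Here z runs through the closed cell of x cut out by the units of T in the orthogonal complement
    of [xs]. *)
Definition cell_nonpos xs x T u := forall z, (forall y, y \in xs -> dotp y z = 0) ->
  (forall i (a : K i), i \in T -> act (x :: xs) a -> act (z :: xs) a) ->
  dotp z u <= 0.

(** Removing from z its component along p changes neither its value under u, as u vanishes at p, nor
    the comparison of pieces active along [p :: xs]. *)
Lemma cell_nonpos_project xs p x T u : p != 0 ->
  (forall y, y \in xs -> dotp y p = 0) -> dotp p u = 0 ->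
  cell_nonpos (p :: xs) x T u ->
  forall z, (forall y, y \in xs -> dotp y z = 0) ->
    (forall i (a : K i), i \in T -> act (x :: p :: xs) a -> act (z :: xs) a) ->
    dotp z u <= 0.
Proof.
move=> p0 op pu cx z oz hz; pose s := dotp z p / dotp p p.
have zp : dotp p (z + (- s) *: p) = 0.
  by rewrite dotpDr dotpZr mulNr divfK ?gt_eqF ?dotpxx_gt0 // dotpC subrr.
have := cx (z + (- s) *: p); rewrite dotpDl dotpZl pu mulr0 addr0; apply.
  move=> y; rewrite inE => /predU1P[-> //|yin].
  by rewrite dotpDr dotpZr oz // op // mulr0 addr0.
move=> i a iT ha; apply/(act_shift _ _ _ _ (mem_head p xs)).
apply: act_cons_sub (hz _ _ iT ha); first by move=> b; exact: act_tail.
exact: act_tail ha.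
Qed.

(** Induction on |T|. At a ray p with u nonpositive where all of T but i is tied, [few_ties] leaves
    i untied. A form nonnegative on the cell is added to u so that the sum vanishes at p, and the
    induction hypothesis applies along [p :: xs]. *)
Lemma exists_cell_nonpos xs T u : few_ties -> ortho_flag xs -> (#|T| + size xs = d)%N ->
  (forall i, i \in T -> tied xs i) ->
  exists x, (forall i, i \in T -> ~ tied (x :: xs) i) /\ cell_nonpos xs x T u.
Proof.
move=> few; move: {2}#|T| (leqnn #|T|) => n; elim: n => [|n IH] in T xs u *.
  rewrite leqn0 cards_eq0 => /eqP ->; rewrite cards0 add0n => oxs sz _.
  (* With T empty the flag has d vectors, so only 0 is orthogonal to it. *)
  exists 0; split=> [i|z oz _]; first by rewrite inE.
  have [->|z0] := eqVneq z 0; first by rewrite dotp0l.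
  by have := @ortho_size _ _ (z :: xs) (And3 z0 oz oxs); rewrite /= sz ltnn.
have [->|[i iT]] := set_0Vmem T; first by move=> _ oxs sz tT; apply: IH => //; rewrite cards0.
move=> cT oxs sz tT; pose T' := T :\ i.
have cT' : #|T'|.+1 = #|T| by rewrite (cardsD1 i T) iT.
have T'T j : j \in T' -> j \in T by rewrite inE => /andP[].
have cT'n : (#|T'| <= n)%N by rewrite -ltnS cT'.
have szT' : (size xs + #|T'| < d)%N by apply: leq_trans (eq_leq sz); rewrite addnC -cT'.
have [p [p0 [op tp] pu]] := tied_extension k0 u szT' (fun j jT => tT j (T'T j jT)).
have opxs : ortho_flag (p :: xs) by split.
have nti : ~ tied (p :: xs) i.
  move=> ti; suff : (#|T| + size xs < d)%N by rewrite sz ltnn.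
  apply: few opxs _ => j jT; have [->//|ji] := eqVneq j i; apply: tp.
  by rewrite !inE ji.
have [a ha] := act_nonempty alpha k0 (p :: xs) i.
have [b hb ab] : exists2 b : K i, act xs b & alpha b <> alpha a.
  have [b [c [hb hc bc]]] := tT i iT.
  have [eb|] := pselect (alpha b = alpha a); last by exists b.
  by exists c => // ec; apply: bc; rewrite eb.
(* Equality would make b active at p as well, and i, being untied there, would give b the gradient
   of a. *)
have hp : 0 < dotp p (alpha a - alpha b).
  rewrite dotpBr subr_gt0 lt_neqAle (ha.2 b hb) andbT.
  apply/eqP => eqp; apply: ab; apply: (untiedE nti) => //.
  by split => // b' /ha.2; rewrite eqp.
pose c := - dotp p u / dotp p (alpha a - alpha b).
have c0 : 0 <= c by rewrite divr_ge0 ?oppr_ge0 // ltW.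
pose u' := u + c *: (alpha a - alpha b).
have pu' : dotp p u' = 0.
  by rewrite dotpDr dotpZr divfK ?gt_eqF // subrr.
have szp : (#|T'| + size (p :: xs) = d)%N by rewrite /= addnS -addSn cT'.
have [y [nty cy]] := IH T' (p :: xs) u' cT'n opxs szp tp.
have [t t0 ht] := act_pert alpha p y xs.
exists (p + t *: y); split.
  move=> j jT /(tied_iff (ht j)) tj.
  have [ji|ji] := eqVneq j i; first by apply: nti; rewrite -ji; apply: tied_tail tj.
  by apply: nty tj; rewrite !inE ji.
move=> z oz hz.
have zu' : dotp z u' <= 0.
  apply: (cell_nonpos_project p0 op pu' cy oz) => j b' /T'T jT hb'.
  by apply: hz => //; apply/ht.
have [a' ha'] := act_nonempty alpha k0 (p + t *: y :: xs) i.
have eqa : alpha a' = alpha a.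
  by apply: (untiedE nti) => //; move/ht: ha' => [].
have := (hz i a' iT ha').2 b hb; rewrite eqa => hz'.
have : 0 <= c * dotp z (alpha a - alpha b).
  by rewrite mulr_ge0 // dotpBr subr_ge0.
move: zu'; rewrite /u' (dotpDr u) dotpZr; lra.
Qed.

(** Summing over all pieces avoids choosing a competitor of a, and the result depends on a only
    through its gradient. *)
Definition excess i (a : K i) : 'rV[R]_d := \sum_(b : K i) (alpha a - alpha b).

Lemma excess_ge0 i (a : K i) z : act [:: z] a -> 0 <= dotp z (excess a).
Proof.
move=> [_ h]; rewrite dotp_sumr; apply: sumr_ge0 => b _.
by rewrite dotpBr subr_ge0 h.
Qed.

(** If the sum vanished, every piece would be active at z; as i is untied there, all gradients would
    coincide. *)
Lemma excess_gt0 i (a : K i) z : tied [::] i -> ~ tied [:: z] i -> act [:: z] a ->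
  0 < dotp z (excess a).
Proof.
move=> [b [c [_ _ bc]]] nt ha; rewrite lt_def excess_ge0 // andbT.
apply/eqP; rewrite dotp_sumr => z0.
have term (e : K i) : true -> 0 <= dotp z (alpha a - alpha e).
  by rewrite dotpBr subr_ge0 => _; case: ha => _; apply.
have hall (e : K i) : alpha e = alpha a.
  apply: (untiedE nt) => //; split => // e' _.
  have : dotp z (alpha a - alpha e) = 0 by exact: (psumr_eq0P term z0).
  rewrite dotpBr => /eqP.
  by rewrite subr_eq0 => /eqP <-; case: ha => _; apply.
by apply: bc; rewrite !hall.
Qed.

(** The last clause makes c the minimum of [- dotp z w / dotp z (excess a)] over the points z of the
    closed cell with positive excess, attained at p. *)
Lemma exists_cell_at_ray T i0 p w : few_ties -> (forall i, tied [::] i) ->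
  p != 0 -> (forall i, i \in T -> tied [:: p] i) -> (#|T|.+1 = d)%N ->
  i0 \notin T -> dotp p w <= 0 ->
  exists x c, [/\ forall i, ~ tied [:: x] i,
    forall i (a : K i), act [:: x] a -> act [:: p] a,
    0 <= c & forall a : K i0, act [:: x] a ->
      [/\ 0 < dotp p (excess a), dotp p w = - (c * dotp p (excess a)) &
      forall z, (forall i (b : K i), act [:: x] b -> act [:: z] b) ->
        dotp z w <= - (c * dotp z (excess a))]].
Proof.
move=> few t0 p0 tp cT i0T pw.
have op : ortho_flag [:: p] by split.
have nt i : i \notin T -> ~ tied [:: p] i.
  move=> iT ti; suff : (#|i |: T| + size ([::] : seq 'rV[R]_d) < d)%N.
    by rewrite cardsU1 iT add1n cT addn0 ltnn.
  apply: few op _ => j.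
  by rewrite in_setU1 => /predU1P[->//|]; exact: tp.
have [a ha] := act_nonempty alpha k0 [:: p] i0.
have hp := excess_gt0 (t0 i0) (nt i0 i0T) ha.
pose c := - dotp p w / dotp p (excess a).
pose u := w + c *: excess a.
have pu : dotp p u = 0 by rewrite dotpDr dotpZr divfK ?gt_eqF // subrr.
have sz : (#|T| + size [:: p] = d)%N by rewrite addn1.
have [y [nty cy]] := exists_cell_nonpos u few op sz tp.
have [t tt ht] := act_pert alpha p y [::].
have xp i (b : K i) : act [:: p + t *: y] b -> act [:: p] b.
  by move/ht; exact: act_tail.
exists (p + t *: y), c; split => //.
- move=> i /(tied_iff (ht i)) ti; have [iT|iT] := boolP (i \in T).
    exact: nty ti.
  by apply: (nt i iT); exact: tied_tail ti.
- by rewrite divr_ge0 ?oppr_ge0 // ltW.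
move=> a' /xp ha'.
have ea : excess a' = excess a.
  by apply: eq_bigr => b _; rewrite (untiedE (nt i0 i0T) ha' ha).
rewrite ea; split => //; first by rewrite divfK ?gt_eqF // opprK.
move=> z hz; suff : dotp z u <= 0 by rewrite dotpDr dotpZr; lra.
apply: (cell_nonpos_project p0 _ pu cy) => // i b iT hb.
by apply: hz; apply/ht.
Qed.

End Cells.

(** * Flags replaced by single vectors *)

Section Flags.
Set Implicit Arguments.
Unset Strict Implicit.
Context {R : realType} {d : nat} {I : finType} {K : I -> finType}.
Variables (alpha : forall i, K i -> 'rV[R]_d).
Implicit Types (x y v : 'rV[R]_d) (xs : seq 'rV[R]_d).
Local Notation act := (act alpha).

(** Iterates [act_pert]. The newest vector x is kept apart, with positive coefficient, so that it
    can be isolated modulo the span of the older ones. *)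
Lemma act_collapse x xs : exists v (s : R), [/\ 0 < s, v \in <<xs>>%VS &
  forall i (a : K i), act [:: v + s *: x] a <-> act (x :: xs) a].
Proof.
elim: xs x => [|y xs IH] x.
  by exists 0, 1; split=> [||i a]; rewrite ?mem0v // add0r scale1r.
have [t t0 ht] := act_pert alpha y x xs.
have [v [s [s0 vxs hv]]] := IH (y + t *: x).
exists (v + s *: y), (s * t); split=> [||i a]; first by rewrite mulr_gt0.
  rewrite span_cons addrC memv_add // ?memvZ ?memv_line //.
by rewrite -scalerA -addrA -scalerDr; apply: iff_trans (hv i a) (ht i a).
Qed.

(** By induction the older vectors lie in V; the collapsed vector [v + s *: x] does too, with v in
    their span, and this forces x into V. *)
Lemma flag_in_subspace (V : {vspace 'rV[R]_d}) xs :
  (forall v, (forall i (a : K i), act xs a -> act [:: v] a) -> v \in V) ->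
  forall x, x \in xs -> x \in V.
Proof.
elim: xs => [//|x xs IH] h.
have xsV : forall y, y \in xs -> y \in V.
  by apply: IH => v hv; apply: h => i a /act_tail; exact: hv.
move=> y; rewrite inE => /predU1P[->|]; last exact: xsV.
have [v [s [s0 vxs hv]]] := act_collapse x xs.
have vV : v \in V by move: vxs; apply/subvP/span_subvP.
have : v + s *: x \in V by apply: h => i a /hv.
by rewrite rpredDl // rpredZeq gt_eqF.
Qed.

End Flags.

(** * From atoms and simplicity to bounds on ties *)

Section Arrangement.
Set Implicit Arguments.
Unset Strict Implicit.
Context {R : realType} {d m : nat} {k : 'I_m -> nat}.
Variable A : forall i : 'I_m, 'I_(k i) -> {scalar 'rV[R]_d}.
Implicit Types (x y z : 'rV[R]_d) (xs : seq 'rV[R]_d).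

Definition grad i (a : 'I_(k i)) : 'rV[R]_d :=
  \row_j A a (delta_mx ord0 j).

Local Notation act := (act grad).
Local Notation tied := (tied grad).

Lemma gradE i (a : 'I_(k i)) x : A a x = dotp x (grad a).
Proof.
rewrite {1}(row_sum_delta x) linear_sum; apply: eq_bigr => j _.
by rewrite linearZ mxE.
Qed.

Lemma tie_setP i (a b : 'I_(k i)) x :
  tie_set A a b x <-> act [:: x] a /\ act [:: x] b.
Proof.
split=> [[eab amax]|[ha hb]].
  split; split => // c _; rewrite -!gradE //; last by rewrite -eab.
split; first by rewrite !gradE; exact: act_val ha hb (mem_head _ _).
by move=> c; rewrite !gradE; case: ha => _; apply.
Qed.

Lemma act0 i (a : 'I_(k i)) : act [:: 0] a.
Proof. by split => // b _; rewrite !dotp0l. Qed.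

Lemma affine_dim_subspace (S : set 'rV[R]_d) e : S 0 -> affine_dim S e ->
  exists V : {vspace 'rV[R]_d}, \dim V = e /\ forall x, S x -> x \in V.
Proof.
move=> S0 [x0 [V [Sx0 dV SV _]]]; exists V; split => // x /SV h.
have : 0 - x0 \in V by exact: SV.
by rewrite sub0r rpredN -[in x \in V](subrK x0 x); exact: rpredD.
Qed.

Lemma grad_sub_ortho xs i (a b : 'I_(k i)) : act xs a -> act xs b ->
  forall x, x \in xs -> dotp x (grad a - grad b) = 0.
Proof.
by move=> ha hb x xin; rewrite dotpBr (act_val ha hb xin) subrr.
Qed.

(** The gradient difference h completes the flag to an orthogonal basis, so the hyperplane
    orthogonal to h, which contains the tie set, is the span of [xs]. Minimality of this span is
    [flag_in_subspace]. *)
Lemma tie_set_codim1 xs i (a b : 'I_(k i)) : ortho_flag xs -> (size xs).+1 = d ->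
  act xs a -> act xs b -> grad a != grad b -> has_codim (tie_set A a b) 1.
Proof.
move=> oxs sz ha hb ab; set h := grad a - grad b.
have h0 : h != 0 by rewrite subr_eq0.
have oh : ortho_flag (h :: xs) by split => //; exact: grad_sub_ortho.
have full : <<h :: xs>>%VS = fullv.
  apply/eqP; rewrite eqEdim subvf /= dimvf /dim /= mul1n.
  by move/ortho_free/eqP: oh => -> /=; rewrite sz.
exists (size xs); last by rewrite addn1.
exists 0, <<xs>>%VS; split.
- by apply/tie_setP; split; exact: act0.
- by apply/eqP; exact: ortho_free.
- move=> x /tie_setP[xa xb]; rewrite subr0.
  have : x \in <<h :: xs>>%VS by rewrite full memvf.
  rewrite span_cons => /memv_addP[_ /vlineP[c ->] [v vxs ex]].
  have xh : dotp x h = 0 by rewrite (grad_sub_ortho xa xb) // mem_head.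
  have vh : dotp v h = 0.
    by apply: span_ortho vxs => y; exact: grad_sub_ortho.
  move/eqP: xh; rewrite ex dotpDl dotpZl vh addr0 mulf_eq0.
  rewrite [dotp h h == 0]gt_eqF ?dotpxx_gt0 // orbF => /eqP ->.
  by rewrite scale0r add0r.
move=> W hW; apply/span_subvP; apply: (flag_in_subspace (alpha := grad)) => v hv.
by rewrite -(subr0 v); apply: hW; apply/tie_setP; split; exact: hv.
Qed.

Section Nonempty.
Variable k0 : forall i, 'I_(k i).

(** The tie set of two given pieces may have codimension above one. The flag is lengthened with i
    still tied until it has d - 1 vectors, where [tie_set_codim1] applies. *)
Lemma exists_atom xs i : ortho_flag xs -> tied xs i ->
  exists a b : 'I_(k i), [/\ act xs a, act xs b &
    atoms_of_unit A i (tie_set A a b)].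
Proof.
move: {2}(d - size xs)%N (leqnn (d - size xs)%N) => c; elim: c xs => [|c IH] xs.
all: move=> hc oxs [a [b [ha hb ab]]].
(* The nonzero gradient difference is orthogonal to the flag and would extend it. *)
all: have szlt : (size xs < d)%N by
  apply: (@ortho_size _ _ (grad a - grad b :: xs)); split;
  [by rewrite subr_eq0; exact/eqP | exact: grad_sub_ortho | by []].
  by rewrite leqn0 subn_eq0 leqNgt szlt in hc.
have [sz|sz] := eqVneq (size xs).+1 d.
  exists a, b; split => //; exists a, b; split => //.
    by apply/eqP => eab; apply: ab; rewrite eab.
  by apply: tie_set_codim1 sz _ _ _ => //; exact/eqP.
have szs : (size xs + #|[set i]%SET| < d)%N.
  by rewrite cards1 addn1 ltn_neqAle sz.
have t1 j : j \in [set i]%SET -> tied xs j.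
  by rewrite inE => /eqP ->; exists a, b.
(* Only the ties matter here, so the zero form is used. *)
have [y [y0 [oy ty] _]] := tied_extension k0 0 szs t1.
have oyxs : ortho_flag (y :: xs) by split.
have hc' : (d - size (y :: xs) <= c)%N.
  by rewrite /= subnS -ltnS; apply: leq_trans hc; rewrite prednK // subn_gt0.
have [a' [b' [ha' hb' hab]]] := IH (y :: xs) hc' oyxs (ty i (finset.set11 i)).
by exists a', b'; split => //; [exact: act_tail ha' | exact: act_tail hb'].
Qed.

Lemma atom0 i H : atoms_of_unit A i H -> H 0.
Proof. by move=> [a [b [_ -> _]]]; apply/tie_setP; split; exact: act0. Qed.

(** Each tied unit supplies an atom containing the cell attached to the flag. The intersection of
    these atoms is not {0}, so it has codimension |T|, and its span contains the whole flag. *)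
Lemma simple_few_ties : simple_arrangement A -> few_ties grad.
Proof.
move=> simple x xs T oxs tT.
have /choice[H hH] : forall i, exists H : set 'rV[R]_d, i \in T ->
    atoms_of_unit A i H /\
    forall v, (forall a : 'I_(k i), act (x :: xs) a -> act [:: v] a) -> H v.
  move=> i; have [iT|_] := boolP (i \in T); last by exists setT.
  have [a [b [ha hb hab]]] := exists_atom oxs (tT i iT).
  exists (tie_set A a b) => _; split => // v hv.
  by apply/tie_setP; split; exact: hv.
have mem v : (forall i (a : 'I_(k i)), act (x :: xs) a -> act [:: v] a) ->
    (\bigcap_(i in [set` T]) H i) v.
  by move=> hv i /= iT; exact: (hH i iT).2 (hv i).
have [H0|[e he ed]] := simple T H (fun i iT => (hH i iT).1).
  have : x \in 0%VS.
    apply: (flag_in_subspace (alpha := grad) (xs := x :: xs)); last exact: mem_head.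
    by move=> v /mem; rewrite H0 => -> ; exact: mem0v.
  by rewrite memv0; case: oxs => /negbTE ->.
have S0 : (\bigcap_(i in [set` T]) H i) 0.
  by move=> i /= iT; apply: atom0 (hH i iT).1.
have [V [dV hV]] := affine_dim_subspace S0 he.
have : (size (x :: xs) <= e)%N.
  rewrite -dV; apply: ortho_size_le oxs _.
  by apply: (flag_in_subspace (alpha := grad)) => v /mem /hV.
move=> /= sz; apply: leq_trans (eq_leq ed); rewrite addnC.
by rewrite -addSn leq_add2r.
Qed.

Lemma codim1_proper (S : set 'rV[R]_d) : S 0 -> has_codim S 1 ->
  exists V : {vspace 'rV[R]_d}, (forall x, S x -> x \in V) /\ V <> fullv.
Proof.
move=> S0 [e /(affine_dim_subspace S0)[V [dV hV]] ed]; exists V; split => // V1.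
move: ed; rewrite -dV V1 dimvf /dim /= mul1n addn1 => /eqP.
by rewrite -[X in _ == X]addn0 -addn1 eqn_add2l.
Qed.

(** Tie sets of codimension other than one are not atoms. If i is untied at x, a tie set through x
    contains a small step from x in each direction and cannot have codimension one; conversely,
    [exists_atom] finds an atom through a tie. *)
Lemma covered_tied x :
  (\bigcup_(H in maxout_arrangement A) H) x <-> exists i, tied [:: x] i.
Proof.
split=> [[H [i [a [b [_ -> cod]]]] hx]|[i ti]].
  exists i; apply: contrapT => nt.
  have S0 : tie_set A a b 0 by apply/tie_setP; split; exact: act0.
  have [V [hV VN]] := codim1_proper S0 cod.
  apply: VN; apply/vspaceP => z; rewrite memvf.
  have [t t0 ht] := act_pert grad x z [::].
  have /tie_setP[xa xb] := hx.
  have ext (c : 'I_(k i)) : act [:: x] c -> act [:: x + t *: z] c.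
    by move=> xc; apply/ht; split => // c' xc'; rewrite (untiedE nt xc xc').
  have : x + t *: z \in V by apply: hV; apply/tie_setP; split; exact: ext.
  by rewrite rpredDl ?(hV _ hx) // rpredZeq gt_eqF.
have [a [b [ha hb hab]]] : exists a b : 'I_(k i), [/\ act [:: x] a, act [:: x] b &
    atoms_of_unit A i (tie_set A a b)].
  (* The vector 0 cannot head a flag, but every atom of i passes through it. *)
  have [->|x0] := eqVneq x 0.
    have [a [b [_ _ hab]]] := exists_atom (xs := [::]) Logic.I (tied_tail ti).
    by exists a, b; split => //; exact: act0.
  by apply: exists_atom ti; split.
by exists (tie_set A a b); [exists i | apply/tie_setP].
Qed.

End Nonempty.
End Arrangement.

(** * Regions as sets of points with equal activity pattern *)

Section Patterns.
Set Implicit Arguments.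
Unset Strict Implicit.
Context {R : realType} {d : nat} {I : finType} {K : I -> finType}.
Variables (alpha : forall i, K i -> 'rV[R]_d) (k0 : forall i, K i).
Implicit Types (x y z : 'rV[R]_d) (E : set 'rV[R]_d) (P : {set {i : I & K i}}).
Local Notation act := (act alpha).
Local Notation tied := (tied alpha).

(** All active pieces are recorded, since different indices of a unit may carry the same
    gradient. *)
Definition pattern x : {set {i : I & K i}} :=
  [set s | `[< act [:: x] (tagged s) >]]%SET.

Definition untied x := forall i, ~ tied [:: x] i.

Lemma patternP x y :
  pattern x = pattern y <-> forall i (a : K i), act [:: x] a <-> act [:: y] a.
Proof.
split=> [/setP h i a|h].
  by have := h (Tagged K a); rewrite !inE /= => e; split=> /asboolP;
    [rewrite e | rewrite -e] => /asboolP.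
by apply/setP => -[i a]; rewrite !inE /=; apply/asboolP/asboolP => /h.
Qed.

Lemma untied_pattern x y : pattern x = pattern y -> untied x -> untied y.
Proof. by move=> /patternP h ux i /(tied_iff (h i)); exact: ux. Qed.

(** Describes a cell by finitely many strict linear inequalities, whence its openness and
    convexity. *)
Lemma pattern_strictP x y : untied x ->
  pattern y = pattern x <->
  forall i (a b : K i), act [:: x] a -> alpha b != alpha a ->
    dotp y (alpha b) < dotp y (alpha a).
Proof.
move=> ux; split=> [pyx i a b /((patternP y x).1 pyx) ha ba|h].
  rewrite lt_neqAle ha.2 // andbT; apply: contra_neq ba => eba.
  have hb : act [:: y] b by split => // c _; rewrite eba ha.2.
  by apply: (untiedE _ hb ha); apply: (untied_pattern (esym pyx) ux).
apply/patternP => i c; have [a ha] := act_nonempty alpha k0 [:: x] i.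
have le_a (b : K i) : dotp y (alpha b) <= dotp y (alpha a).
  by have [->//|/(h i a b ha)/ltW] := eqVneq (alpha b) (alpha a).
split=> hc; last first.
  by split => // b _; rewrite (untiedE (ux i) hc ha).
have eca : alpha c = alpha a.
  apply/eqP; apply: contraT => /(h i a c ha).
  by rewrite ltNge hc.2.
by split => // b _; rewrite eca; case: ha => _; apply.
Qed.

Lemma open_cell x : untied x -> open [set y | pattern y = pattern x].
Proof.
move=> ux; rewrite -closedC.
pose D : set {i : I & (K i * K i)%type} := [set s |
  act [:: x] (tagged s).1 /\ alpha (tagged s).2 != alpha (tagged s).1].
rewrite (_ : ~` _ = \bigcup_(s in D)
    (fun y => dotp y (alpha (tagged s).1 - alpha (tagged s).2)) @^-1`
      [set r | r <= 0]).
  apply: closed_bigcup; first exact: finite_finset.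
  move=> s _; apply: closed_level; last exact: closed_le.
  exact: continuous_dotp.
apply/seteqP; split => y /=.
  move=> ny; apply: contrapT => nD; apply/ny/(pattern_strictP _ ux) => i a b ha ba.
  rewrite ltNge; apply/negP => le_ab; apply: nD.
  exists (Tagged (fun i => (K i * K i)%type) (a, b)) => //=.
  by rewrite dotpBr subr_le0.
move=> [[i [a b]] [/= ha ba] hab] /(pattern_strictP _ ux)/(_ i a b ha ba).
by rewrite ltNge; rewrite dotpBr subr_le0 in hab; rewrite hab.
Qed.

Definition convex E := forall x y (t : R), E x -> E y -> 0 <= t <= 1 ->
  E (x + t *: (y - x)).

Lemma convex_connected E : convex E -> connected E.
Proof.
move=> cE; have [->|/set0P[x Ex]] := eqVneq E set0; first exact: connected0.
pose seg y : set 'rV[R]_d := (fun t : R => x + t *: (y - x)) @` `[0, 1]%classic.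
have -> : E = \bigcup_(y in E) seg y.
  apply/seteqP; split => z.
    move=> Ez; exists z => //; exists 1; first by rewrite /= in_itv /= ler01 lexx.
    by rewrite scale1r addrC subrK.
  by move=> [y Ey [t /= ht <-]]; apply: cE; rewrite // -in_itv.
apply: bigcup_connected.
  exists x => y Ey; exists 0; first by rewrite /= in_itv /= ler01 lexx.
  by rewrite scale0r addr0.
move=> y _; apply: connected_continuous_connected; first exact: segment_connected.
apply: continuous_subspaceT => t.
exact: (cvgD (cvg_cst x) (@scalel_continuous R _ (y - x) t)).
Qed.

Lemma convex_cell x : untied x -> convex [set y | pattern y = pattern x].
Proof.
move=> ux y z t /= /(pattern_strictP _ ux) hy /(pattern_strictP _ ux) hz /andP[t0 t1].
apply/(pattern_strictP _ ux) => i a b ha ba.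
rewrite !dotpDl !dotpZl !dotpBl.
have hyab := hy i a b ha ba; have hzab := hz i a b ha ba.
move: (dotp y (alpha b)) (dotp y (alpha a)) (dotp z (alpha b)) (dotp z (alpha a))
  hyab hzab => p q r s hpq hrs.
have [->|tn] := eqVneq t 0; first by rewrite !mul0r !addr0.
have t_gt0 : 0 < t by rewrite lt_def tn.
have : 0 < t * (s - r) by rewrite mulr_gt0 // subr_gt0.
have : 0 <= (1 - t) * (q - p) by rewrite mulr_ge0 ?subr_ge0 // ltW.
by lra.
Qed.

(** The cell is connected by convexity. It is open, and among untied points its complement is the
    union of the other open cells, so the component cannot leave it. *)
Lemma component_cell E x : convex E -> E x -> untied x ->
  connected_component (E `&` [set y | untied y]) x =
  E `&` [set y | pattern y = pattern x].
Proof.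
move=> cE Ex ux; set C := connected_component _ _.
apply/seteqP; split; last first.
  apply: connected_component_max => //.
    by move=> y [Ey /esym/untied_pattern h]; split => //; exact: h.
  apply: convex_connected => y z t [Ey Py] [Ez Pz] ht; split; first exact: cE.
  exact: convex_cell.
suff -> : C = C `&` [set y | pattern y = pattern x].
  by move=> y [/connected_component_sub[Ey _] Py].
have Cx : C x by apply: connected_component_refl; split.
apply/esym; apply: (component_connected (A := E `&` [set y | untied y]) (x := x)).
- by exists x.
- by exists [set y | pattern y = pattern x] => //; exact: open_cell.
exists (~` \bigcup_(z in [set z | untied z /\ pattern z <> pattern x])
  [set y | pattern y = pattern z]).
  by rewrite closedC; apply: bigcup_open => z [uz _]; exact: open_cell.
apply/seteqP; split => y [Cy hy]; split => //.
  by move=> [z [_ zx] /= yz]; apply: zx; rewrite -yz.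
apply: contrapT => yx; apply: hy; exists y => //; split => //.
by have [] := connected_component_sub Cy.
Qed.

Definition realized E : {set {set {i : I & K i}}} :=
  [set P | `[< exists x, [/\ E x, untied x & pattern x = P] >]]%SET.

Lemma realizedP E P :
  reflect (exists x, [/\ E x, untied x & pattern x = P]) (P \in realized E).
Proof. by rewrite inE; apply: asboolP. Qed.

Definition pattern_cell E P : set 'rV[R]_d := E `&` [set y | pattern y = P].

Lemma regions_realized E arr : convex E ->
  E `\` \bigcup_(H in arr) H = E `&` [set y | untied y] ->
  regions E arr = pattern_cell E @` [set` realized E].
Proof.
move=> cE hE; rewrite /regions hE; apply/seteqP; split => C.
  move=> [x [Ex ux] <-]; exists (pattern x); first by apply/realizedP; exists x.
  by rewrite component_cell.
move=> [P /realizedP[x [Ex ux <-]] <-]; exists x => //.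
by rewrite component_cell.
Qed.

Lemma card_pattern_cells E (D : {set {set {i : I & K i}}}) :
  D \subset realized E -> pattern_cell E @` [set` D] #= `I_#|D|.
Proof.
move=> /fintype.subsetP DE.
have inj : {in [set` D] &, injective (pattern_cell E)}.
  move=> P Q; rewrite !inE => /DE/realizedP[x [Ex _ xP]] _ /seteqP[PQ _].
  by have [_ <-] := PQ x (conj Ex xP).
rewrite (card_eql (inj_card_eq inj)).
have -> : [set` D] = enum_val @` [set: 'I_#|D|].
  apply/seteqP; split => [P PD|_ [j _ <-]]; last exact: enum_valP.
  by exists (enum_rank_in PD P) => //; rewrite enum_rankK_in.
rewrite (card_eql (inj_card_eq _)); last by move=> i j _ _; exact: enum_val_inj.
by rewrite card_eq_sym card_II.
Qed.

End Patterns.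

(** * Counting the cells that miss the hyperplane *)

Section LowerBound.
Set Implicit Arguments.
Unset Strict Implicit.
Context {R : realType} {d : nat} {I : finType} {K : I -> finType}.
Variables (alpha : forall i, K i -> 'rV[R]_d) (k0 : forall i, K i).
Implicit Types (x y z p q w : 'rV[R]_d) (T : {set I}).
Local Notation act := (act alpha).
Local Notation tied := (tied alpha).
Local Notation untied := (untied alpha).
Local Notation pattern := (pattern alpha).
Local Notation realized := (realized alpha).
Local Notation excess := (excess alpha).

(** The vectors e j are treated one at a time, by steps too small to spoil the finitely many
    conditions already met. *)
Lemma generic_perturbation (J X : finType) (e : J -> 'rV[R]_d)
    (q : X -> 'rV[R]_d) w : (forall i, 0 < dotp (q i) w) ->
  exists w', (forall i, 0 < dotp (q i) w') /\
    forall j, e j != 0 -> dotp (e j) w' != 0.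
Proof.
move=> qw.
suff [w' [qw' ew']] : exists w', (forall i, 0 < dotp (q i) w') /\
    forall j, j \in enum J -> e j != 0 -> dotp (e j) w' != 0.
  by exists w'; split => // j; apply: ew'; rewrite mem_enum.
elim: (enum J) => [|j s [w' [qw' ew']]]; first by exists w; split.
have [ejw|ejw] := boolP ((e j != 0) ==> (dotp (e j) w' != 0)).
  exists w'; split => // l; rewrite inE => /predU1P[->|/ew' //].
  exact/implyP.
move: ejw; rewrite negb_imply => /andP[ej0 /negPn/eqP ejw].
pose v (s : X + J) := match s with inl i => q i | inr l => e l end.
have [t t0 ht] := small_scale (fun s => dotp (v s) w') (fun s => dotp (v s) (e j)).
(* The direction e j has positive product with itself, which moves the vanishing product off 0. *)
exists (w' + t *: e j); split.
  move=> i; have := ht (inl i); rewrite /v gt_eqF // => /(_ isT).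
  rewrite -[t in t * _]gtr0_norm // -normrM dotpDr dotpZr (gtr0_norm (qw' i)).
  by rewrite ltr_norml => /andP[+ _]; lra.
move=> l; rewrite inE => /predU1P[->|ls] el0.
  by rewrite dotpDr dotpZr ejw add0r mulf_neq0 ?gt_eqF // dotpxx_gt0.
have := ht (inr l) (ew' l ls el0); rewrite /= -[t in t * _]gtr0_norm // -normrM.
rewrite dotpDr dotpZr; apply: contraTneq => /eqP; rewrite addr_eq0 => /eqP ->.
by rewrite normrN ltxx.
Qed.

(** Otherwise the part of q orthogonal to p would extend p to a flag of two vectors along which all
    d - 1 units of T stay tied. *)
Lemma tied_ray_unique T p q : few_ties alpha -> (#|T|.+1 = d)%N ->
  p != 0 -> q != 0 -> (forall i, i \in T -> tied [:: p] i) ->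
  pattern p = pattern q -> exists2 s, s != 0 & q = s *: p.
Proof.
move=> few cT p0 q0 tp /patternP pq; pose s := dotp q p / dotp p p.
have [q'0|q'0] := eqVneq (q + (- s) *: p) 0.
  have qE : q = s *: p by apply/eqP; rewrite -subr_eq0 -scaleNr q'0.
  by exists s => //; apply: contra_neq q0 => s0; rewrite qE s0 scale0r.
suff : (#|T| + size [:: p] < d)%N by rewrite addn1 cT ltnn.
apply: (few (q + (- s) *: p)).
  split => //.
  move=> y; rewrite inE => /eqP ->.
  by rewrite dotpDr dotpZr mulNr divfK ?gt_eqF ?dotpxx_gt0 // dotpC subrr.
move=> i iT; have [a [b [ha hb ab]]] := tp i iT.
have ext (c : K i) : act [:: p] c -> act [:: q + (- s) *: p; p] c.
  move=> hc; apply/act_shift; first exact: mem_head.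
  by apply: (@act_cons_sub _ _ _ _ _ _ _ [::]); [| |apply/pq].
by exists a, b; split => //; exact: ext.
Qed.

(* For generic [w'] the line spanned by the ray p of a set S of units can be
   recovered from the cell attached to it, as the minimiser on the closed cell
   of [- dotp z w' / dotp z (excess a)], where [a] is the active piece of [i0]. *)
Lemma lower_cells_card (i0 : I) w : few_ties alpha ->
  (forall i, tied [::] i) -> w != 0 ->
  ('C(#|I|.-1, d.-1) <=
     #|realized setT :\: realized (affine_hyperplane w)|)%N.
Proof.
move=> few t0 w0; set G := realized (affine_hyperplane w).
have d_gt0 : (0 < d)%N.
  by have := @ortho_size _ _ [:: w]; apply; split.
(* By [tied_ray_unique] one representative per pattern stands for every ray up to a scalar, so
   finitely many genericity conditions suffice. *)
have /choice[r hr] : forall P : {set {i : I & K i}}, exists p,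
    forall q, q != 0 -> pattern q = P -> p != 0 /\ pattern p = P.
  move=> P; have [[p [p0 pP]]|nP] := pselect (exists p, p != 0 /\ pattern p = P).
    by exists p.
  by exists 0 => q q0 qP; case: nP; exists q.
(* These witnesses keep every cell that meets the hyperplane on the positive side of some point
   after perturbation; other patterns get w as a default. *)
have /choice[q hq] : forall P, exists x, 0 < dotp x w /\
    (P \in G -> pattern x = P).
  move=> P; have [/realizedP[x [xw _ xP]]|_] := boolP (P \in G).
    by exists x; rewrite xw.
  by exists w; split => //; exact: dotpxx_gt0.
(* The product of this vector with w' vanishes when w' and the excess have the same ratio at both
   rays; genericity then makes the vector itself zero. *)
pose e (j : {set {i : I & K i}} * {set {i : I & K i}} * {i : I & K i}) :=
  dotp (r j.1.2) (excess (tagged j.2)) *: r j.1.1 -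
  dotp (r j.1.1) (excess (tagged j.2)) *: r j.1.2.
have [w' [qw' ew']] := generic_perturbation e (fun P => (hq P).1).
pose good (T : {set I}) := (T \subset ~: [set i0]%SET) && (#|T| == d.-1).
have /choice[f hf] : forall T, exists x, good T -> exists p c,
    [/\ p != 0, forall i, i \in T -> tied [:: p] i, untied x &
    (forall i (a : K i), act [:: x] a -> act [:: p] a) /\
    forall a : K i0, act [:: x] a ->
      [/\ 0 < dotp p (excess a), dotp p w' = - (c * dotp p (excess a)), 0 <= c &
      forall z, (forall i (b : K i), act [:: x] b -> act [:: z] b) ->
        dotp z w' <= - (c * dotp z (excess a))]].
  move=> T; have [/andP[Ti0 /eqP cT]|_] := boolP (good T); last by exists 0.
  have cT1 : #|T|.+1 = d by rewrite cT prednK.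
  have szT : (size ([::] : seq 'rV[R]_d) + #|T| < d)%N by rewrite add0n -cT1.
  have [p [p0 [_ tp] pw]] := tied_extension k0 w' szT (fun i _ => t0 i).
  have i0T : i0 \notin T.
    by apply/negP => /(fintype.subsetP Ti0); rewrite !inE eqxx.
  have [x [c [ux xp c0 hc]]] := exists_cell_at_ray k0 few t0 p0 tp cT1 i0T pw.
  exists x => _; exists p, c; split => //; split => // a /hc[h1 h2 h3].
  by split.
have -> : 'C(#|I|.-1, d.-1) = #|[set T : {set I} | good T]%SET|.
  rewrite cards_draws cardsC1; congr binomial.
rewrite -(card_in_imset (f := pattern \o f)); last first.
  move=> T1 T2; rewrite !inE => g1 g2 /= /patternP f12.
  have [p1 [c1 [p10 tp1 ux1 [xp1 h1]]]] := hf T1 g1.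
  have [p2 [c2 [p20 tp2 ux2 [xp2 h2]]]] := hf T2 g2.
  have [a ha] := act_nonempty alpha k0 [:: f T1] i0.
  have [e1 v1 c10 m1] := h1 a ha.
  have [e2 v2 c20 m2] := h2 a ((f12 _ _).1 ha).
  (* Each ray lies in the closed cell of the other, so each minimum bounds the other. *)
  have c12 : c1 = c2.
    have l1 := m1 p2 (fun i b hb => xp2 i b ((f12 i b).1 hb)).
    have l2 := m2 p1 (fun i b hb => xp1 i b ((f12 i b).2 hb)).
    rewrite v2 lerN2 (ler_pM2r e2) in l1; rewrite v1 lerN2 (ler_pM2r e1) in l2.
    by apply/eqP; rewrite eq_le l1.
  have cT (T : {set I}) : good T -> #|T|.+1 = d.
    by move=> /andP[_ /eqP ->]; rewrite prednK.
  have [r10 r1p] := hr _ _ p10 erefl.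
  have [r20 r2p] := hr _ _ p20 erefl.
  have [s1 s10 rp1] := tied_ray_unique few (cT _ g1) p10 r10 tp1 (esym r1p).
  have [s2 s20 rp2] := tied_ray_unique few (cT _ g2) p20 r20 tp2 (esym r2p).
  pose h := excess a.
  have eE : e (pattern p1, pattern p2, Tagged K a) =
      (s1 * s2) *: (dotp p2 h *: p1 - dotp p1 h *: p2).
    rewrite /e /= rp1 rp2 !dotpZl !scalerA scalerBr !scalerA.
    by congr (_ *: _ - _ *: _); rewrite -/h; ring.
  have /eqP : dotp p2 h *: p1 - dotp p1 h *: p2 = 0.
    have := ew' (pattern p1, pattern p2, Tagged K a).
    rewrite eE scaler_eq0 mulf_eq0 (negbTE s10) (negbTE s20) /= dotpZl dotpBl.
    rewrite !dotpZl v1 v2 c12 => hne; apply/eqP; apply: contraT => /hne/negP; case.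
    by apply/eqP; rewrite /h; ring.
  rewrite subr_eq0 => /eqP p12.
  have p2E : p2 = (dotp p2 h / dotp p1 h) *: p1.
    by rewrite mulrC -scalerA p12 scalerA mulVf ?scale1r // gt_eqF.
  have tp2' i : i \in T2 -> tied [:: p1] i.
    move=> /tp2; rewrite p2E => h2i.
    by apply/(tied_iff (fun b : K i => act_scale _ p1 [::] b (divr_gt0 e2 e1))).
  (* The rays coincide, so both sets are tied at p1; their union has at most d - 1 elements, the
     size of each. *)
  have : (#|T1 :|: T2| < d)%N.
    have := few p1 [::] (T1 :|: T2); rewrite addn0; apply; first by split.
    by move=> i; rewrite inE => /orP[/tp1|/tp2'].
  rewrite -(cT T1 g1) ltnS => le12.
  have T1E : T1 = T1 :|: T2 by apply/eqP; rewrite eqEcard finset.subsetUl.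
  apply/esym/eqP; rewrite eqEcard {1}T1E finset.subsetUr /=.
  by rewrite -ltnS (cT _ g1) -(cT _ g2).
apply: subset_leq_card; apply/fintype.subsetP => P /imsetP[T].
rewrite inE => gT ->; have [p [c [p0 tp ux [xp h]]]] := hf T gT.
rewrite finset.in_setD; apply/andP; split; last by apply/realizedP; exists (f T).
(* A cell meeting the hyperplane would contain its witness, where w' is positive, but w' is
   nonpositive on the cell. *)
apply/negP => fG; have [_ /(_ fG) /esym/patternP qf] := hq (pattern (f T)).
have [a ha] := act_nonempty alpha k0 [:: f T] i0.
have [_ _ c0 /(_ (q (pattern (f T))))] := h a ha.
have qw := qw' (pattern (f T)).
have qe : 0 <= dotp (q (pattern (f T))) (excess a) by apply: excess_ge0; apply/qf.
have := mulr_ge0 c0 qe.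
move=> ce /(_ (fun i b => (qf i b).1)); lra.
Qed.

End LowerBound.

(** * The induced arrangement on the hyperplane *)

Section Slice.
Set Implicit Arguments.
Unset Strict Implicit.
Context {R : realType} {d m : nat} {k : 'I_m -> nat}.
Variables (A : forall i : 'I_m, 'I_(k i) -> {scalar 'rV[R]_d}).
Variable k0 : forall i, 'I_(k i).
Implicit Types (x y w : 'rV[R]_d).
Local Notation arr := (maxout_arrangement A).
Local Notation untied := (untied (grad A)).

Lemma uncovered_untied E :
  E `\` \bigcup_(H in arr) H = E `&` [set x | untied x].
Proof.
apply/seteqP; split => x [Ex hx]; split => //.
  by move=> i ti; apply: hx; apply/(covered_tied A k0 x); exists i.
by move=> /(covered_tied A k0 x)[i]; exact: hx.
Qed.

(** Points with nonzero product with w rescale onto the hyperplane, and any other z is the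
    difference of [w + z] and w. *)
Lemma hyperplane_not_sub (V : {vspace 'rV[R]_d}) w : w != 0 ->
  (forall x, affine_hyperplane w x -> x \in V) -> V = fullv.
Proof.
move=> w0 gV; have ww := dotpxx_gt0 w0.
have gV' z : dotp z w != 0 -> z \in V.
  move=> zw; rewrite -(scale1r z) -(divff zw) -scalerA memvZ //.
  by apply: gV; rewrite /affine_hyperplane /= dotpZl mulVf.
apply/vspaceP => z; rewrite memvf; have [zw|/gV' //] := eqVneq (dotp z w) 0.
have wV : w \in V by apply: gV'; rewrite gt_eqF.
have : w + z \in V by apply: gV'; rewrite dotpDl zw addr0 gt_eqF.
by rewrite rpredDl.
Qed.

(** An atom lies in a proper subspace and so cannot contain the hyperplane; hence no atom meeting it
    is discarded. *)
Lemma induced_uncovered w : w != 0 ->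
  affine_hyperplane w `\`
    \bigcup_(H in induced_arrangement (affine_hyperplane w) arr) H =
  affine_hyperplane w `&` [set x | untied x].
Proof.
move=> w0; rewrite -uncovered_untied.
apply/seteqP; split => x [gx hx]; split => //; apply: contra_not hx.
  move=> [H arrH Hx]; exists (affine_hyperplane w `&` H) => //.
  exists H; split => //; last by exists x.
  have [i [a [b [_ -> cod]]]] := arrH.
  have S0 : tie_set A a b 0 by apply/tie_setP; split; exact: act0.
  have [V [hV VN]] := codim1_proper S0 cod.
  by move=> gH; apply: VN; apply: (hyperplane_not_sub w0) => y /gH /hV.
by move=> [_ [H [arrH _ -> _]] [_ Hx]]; exists H.
Qed.

Lemma convex_hyperplane w : convex (affine_hyperplane w).
Proof.
move=> x y t; rewrite /affine_hyperplane /= => xw yw _.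
by rewrite dotpDl dotpZl dotpBl xw yw subrr mulr0 addr0.
Qed.

Lemma pattern_scale x (s : R) : 0 < s ->
  pattern (grad A) (s *: x) = pattern (grad A) x.
Proof. by move=> s0; apply/patternP => i a; exact: act_scale. Qed.

End Slice.

Theorem theorem6p9 (R : realType) (n m : nat) (k : 'I_m -> nat)
    (A : forall i : 'I_m, 'I_(k i) -> {scalar 'rV[R]_n.+1})
    (w : 'rV[R]_n.+1)
    (m_ge1 : (1 <= m)%N)
    (rank_ge2 : forall i : 'I_m, (2 <= k i)%N)
    (not_all_equal : forall i : 'I_m, exists (a b : 'I_(k i)) (x : 'rV[R]_n.+1),
       A i a x <> A i b x)
    (A_simple : simple_arrangement A)
    (w_neq0 : w != 0) :
  let g := affine_hyperplane w in
  let arr := maxout_arrangement A in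
  exists r rg N : nat,
    [/\ regions setT arr #= `I_r,
        regions g (induced_arrangement g arr) #= `I_rg &
        [set C | regions setT arr C /\ C `&` g = set0] #= `I_N] /\
    [/\ (forall C, regions setT arr C ->
           (C `&` g = set0 <-> forall x, C x -> dotp x w <= 0)),
        N%:Z = r%:Z - rg%:Z &
        'C(m.-1, n)%:Z <= r%:Z - rg%:Z].
Proof.
move=> g arr.
have k0 i : 'I_(k i) := Ordinal (ltnW (rank_ge2 i)).
have few := simple_few_ties k0 A_simple.
have t0 i : tied (grad A) [::] i.
  have [a [b [x abx]]] := not_all_equal i.
  by exists a, b; split => // eab; apply: abx; rewrite !gradE eab.
have regT : regions setT arr =
    pattern_cell (grad A) setT @` [set` realized (grad A) setT].
  by apply: regions_realized => //; exact: uncovered_untied.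
have regG : regions g (induced_arrangement g arr) =
    pattern_cell (grad A) g @` [set` realized (grad A) g].
  apply: regions_realized => //; first exact: convex_hyperplane.
  exact: induced_uncovered.
pose D := realized (grad A) setT :\: realized (grad A) g.
have sub : realized (grad A) g \subset realized (grad A) setT.
  apply/fintype.subsetP => P /realizedP[x [_ ux xP]].
  by apply/realizedP; exists x.
(* A cell misses g exactly when its pattern is not realized on g, so the count becomes a difference
   of finite sets. *)
have regD : [set C | regions setT arr C /\ C `&` g = set0] =
    pattern_cell (grad A) setT @` [set` D].
  rewrite regT; apply/seteqP; split => C.
    move=> [[P PT <-] Cg]; exists P => //=; rewrite inE PT andbT.
    apply/negP => /realizedP[x [gx _ xP]].
    by have : set0 x by rewrite -Cg; split.
  move=> [P /=]; rewrite inE => /andP[/realizedP PG PT] <-; split; first by exists P.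
  apply/seteqP; split => // x [[_ xP] gx]; apply: PG.
  have /realizedP[y [_ uy yP]] := PT; exists x; split => //.
  by apply: untied_pattern uy; rewrite yP.
exists #|realized (grad A) setT|, #|realized (grad A) g|, #|D|.
have cardD : #|D|%:Z = #|realized (grad A) setT|%:Z - #|realized (grad A) g|%:Z.
  by rewrite cardsD (finset.setIidPr sub) -subzn // subset_leq_card.
split; split.
- by rewrite regT; exact: card_pattern_cells.
- by rewrite regG; exact: card_pattern_cells.
- by rewrite regD; apply: card_pattern_cells; exact: finset.subsetDl.
(* Cells are invariant under positive scaling, so a point with positive product with w can be moved
   onto g. *)
- rewrite regT => C [P PT <-]; split=> [Cg x [_ xP]|Cw].
    rewrite leNgt; apply/negP => xw.
    have : set0 ((dotp x w)^-1 *: x); last by [].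
    rewrite -Cg; split; first split => //=.
      by rewrite pattern_scale ?invr_gt0.
    by rewrite /g /affine_hyperplane /= dotpZl mulVf ?gt_eqF.
  apply/seteqP; split => // x [/Cw xw]; rewrite /g /affine_hyperplane /= => xw1.
  by move: xw; rewrite xw1 ler10.
- by [].
have := lower_cells_card k0 (Ordinal m_ge1) few t0 w_neq0.
by rewrite card_ord -cardD lez_nat.
Qed.
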